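(* Let $A=(S,\Sigma,\rightarrow,s_0)$ and $A'=(S',\Sigma\cup\mathcal{F},\rightarrow',s'_0)$ be finite probabilistic transition systems, where $\mathcal{F}$ is a finite set of fault labels with $\mathcal{F}\cap\Sigma=\emptyset$. Then $A\preceq_m A'$ if and only if the Verifier has a sure winning strategy from the initial vertex of the stochastic masking game graph $\mathcal{G}_{A,A'}$ for the Boolean objective $\neg\Diamond v_{\mathrm{err}}$; and likewise, $A\preceq_m A'$ if and only if the Verifier has an almost-sure winning strategy from the initial vertex of $\mathcal{G}_{A,A'}$ for $\neg\Diamond v_{\mathrm{err}}$.
   Context: A probabilistic transition system (PTS) is $A=(S,\Sigma,\rightarrow,s_0)$ with a finite set of states $S$, initial state $s_0\in S$, a finite set of actions $\Sigma$, and a finite transition relation $\rightarrow\subseteq S\times\Sigma\times\mathcal{D}(S)$ (written $s\xrightarrow{a}\mu$), where $\mathcal{D}(S)$ is the set of probability distributions on $S$; every state has at least one outgoing transition. $\Delta_s$ is the Dirac distribution at $s$ and $\mathrm{Supp}(\mu)=\{s\mid\mu(s)>0\}$. For $\mu\in\mathcal{D}(S)$, $\mu'\in\mathcal{D}(S')$, a coupling for $(\mu,\mu')$ is $w\in\mathcal{D}(S\times S')$ with $\sum_{t'}w(t,t')=\mu(t)$ and $\sum_{t}w(t,t')=\mu'(t')$; $\Omega(\mu,\mu')$ is the set of all couplings. For $R\subseteq S\times S'$, $\mu\,R^{\#}\,\mu'$ iff there is a coupling $w$ for $(\mu,\mu')$ with $\mathrm{Supp}(w)\subseteq R$. Masking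 simulation: for a nominal PTS $A=(S,\Sigma,\rightarrow,s_0)$ and an implementation PTS $A'=(S',\Sigma\cup\mathcal{F},\rightarrow',s'_0)$, $A\preceq_m A'$ iff there is a relation $M\subseteq S\times S'$ with $s_0\,M\,s'_0$ such that for all $s\,M\,s'$, all $e\in\Sigma$ and all $F\in\mathcal{F}$: (1) if $s\xrightarrow{e}\mu$ then $s'\xrightarrow{e}{}'\mu'$ with $\mu\,M^{\#}\,\mu'$ for some $\mu'$; (2) if $s'\xrightarrow{e}{}'\mu'$ then $s\xrightarrow{e}\mu$ with $\mu\,M^{\#}\,\mu'$ for some $\mu$; (3) if $s'\xrightarrow{F}{}'\mu'$ then $\Delta_s\,M^{\#}\,\mu'$. Stochastic game graphs: $(V,E,V_1,V_2,V_P,v_0,\delta)$ with $V$ partitioned into $V_1,V_2,V_P$, edges $E\subseteq V\times V$, initial vertex $v_0$, and $\delta:V_P\to\mathcal{D}(V)$ with $(v,v')\in E$ iff $v'\in\mathrm{Supp}(\delta(v))$ for $v\in V_P$; $\mathit{Post}(v)=\{v'\mid(v,v')\in E\}$. A play is an infinite sequence $\rho_0\rho_1\cdots$ with $(\rho_k,\rho_{k+1})\in E$. A strategy for Player $i$ maps each finite sequence $\hat\rho v$ with $v\in V_i$ to a (discrete) probability distribution supported in $\mathit{Post}(v)$. Two strategies and a start vertex determine a Markov chain and a probability measure on plays. $\Diamond X$ is the set of plays visiting $X$. A strategy of a player is sure winning for objective $\Phi$ from $v$ if for every opponent strategy every possible play of the resulting Markov chain from $v$ lies in $\Phi$; it is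 almost-sure winning if for every opponent strategy the play lies in $\Phi$ with probability 1. The stochastic masking game graph $\mathcal{G}_{A,A'}$ has Refuter vertices $(s,-,s',-,-,-,\mathsf{R})$ ($s\in S,s'\in S'$) together with a vertex $v_{\mathrm{err}}$; Verifier vertices $(s,\sigma^1,s',\mu,-,-,\mathsf{V})$ with $\sigma\in\Sigma$, $s\xrightarrow{\sigma}\mu$, and $(s,\sigma^2,s',-,\mu',-,\mathsf{V})$ with $\sigma\in\Sigma\cup\mathcal{F}$, $s'\xrightarrow{\sigma}{}'\mu'$ (superscripts $1,2$ tag which system moved); probabilistic vertices $(s,-,s',\mu,\mu',w,\mathsf{P})$ with $w\in\Omega(\mu,\mu')$ and some $\sigma\in\Sigma\cup\mathcal{F}$ such that ($s\xrightarrow{\sigma}\mu$ or ($\sigma\in\mathcal{F}$ and $\mu=\Delta_s$)) and $s'\xrightarrow{\sigma}{}'\mu'$. The Refuter owns Refuter vertices, the Verifier owns Verifier vertices. The initial vertex is $(s_0,-,s'_0,-,-,-,\mathsf{R})$, and $\delta((s,-,s',\mu,\mu',w,\mathsf{P}))((t,-,t',-,-,-,\mathsf{R}))=w(t,t')$. Edges: $(s,-,s',-,-,-,\mathsf{R})\to(s,\sigma^1,s',\mu,-,-,\mathsf{V})$ whenever $s\xrightarrow{\sigma}\mu$; $(s,-,s',-,-,-,\mathsf{R})\to(s,\sigma^2,s',-,\mu',-,\mathsf{V})$ whenever $s'\xrightarrow{\sigma}{}'\mu'$; $(s,\sigma^1,s',\mu,-,-,\mathsf{V})\to(s,-,s',\mu,\mu',w,\mathsf{P})$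 whenever $s'\xrightarrow{\sigma}{}'\mu'$ and $w\in\Omega(\mu,\mu')$; for $\sigma\notin\mathcal{F}$, $(s,\sigma^2,s',-,\mu',-,\mathsf{V})\to(s,-,s',\mu,\mu',w,\mathsf{P})$ whenever $s\xrightarrow{\sigma}\mu$ and $w\in\Omega(\mu,\mu')$; for $F\in\mathcal{F}$, $(s,F^2,s',-,\mu',-,\mathsf{V})\to(s,-,s',\Delta_s,\mu',w,\mathsf{P})$ for the $w\in\Omega(\Delta_s,\mu')$; $(s,-,s',\mu,\mu',w,\mathsf{P})\to(t,-,t',-,-,-,\mathsf{R})$ for $(t,t')\in\mathrm{Supp}(w)$; finally every Verifier vertex, and $v_{\mathrm{err}}$ itself, having no successor other than $v_{\mathrm{err}}$ gets an edge to $v_{\mathrm{err}}$. *)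

(* Defs.v *)
From HB Require Import structures.
From mathcomp Require Import all_boot all_order all_algebra.
From mathcomp Require Import all_classical all_reals all_analysis.
Set Implicit Arguments.
Unset Strict Implicit.
Unset Printing Implicit Defensive.
Import Order.TTheory GRing.Theory Num.Theory.
Local Open Scope classical_set_scope.
Local Open Scope ring_scope.

(* Discrete distributions, given by their mass functions; [esum] is the
   unconditional sum, so that the support is countable for every T and the sum
   is the usual finite one when T is finite. *)
Record dist (R : realType) (T : choiceType) := Dist {
  dmass :> T -> R ;
  dmass_ge0 : forall x, 0 <= dmass x ;
  dmass_sum : (\esum_(x in [set: T]) (dmass x)%:E = 1)%E }.

Section dirac.
Variables (R : realType) (T : choiceType) (x : T).

Lemma ddirac_ge0 y : 0 <= (y == x)%:R :> R.
Proof. exact: ler0n. Qed.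

Lemma ddirac_sum : (\esum_(y in [set: T]) ((y == x)%:R : R)%:E = 1)%E.
Proof.
rewrite (esumID [set x]); last by move=> y _; rewrite lee_fin ler0n.
rewrite setTI esum_set1 ?lee_fin ?ler0n// eqxx esum1 ?adde0// => y [_ /eqP].
by move=> /negPf ->.
Qed.

Definition ddirac : dist R T := Dist ddirac_ge0 ddirac_sum.

End dirac.
Arguments ddirac {R T} x.

Definition infseq (V : Type) : Type := nat -> V.
Definition infseq_display : measure_display. Proof. exact. Qed.

Section cylinders.
Variable V : pointedType.
HB.instance Definition _ := Pointed.copy (infseq V) (nat -> V).

(* X is determined by the first n entries of a sequence.  The elements of V are
   not restricted to be countably many, hence cylinders with arbitrary bases
   rather than the sets [cyl w] only. *)
Definition cylinder_at (n : nat) (X : set (infseq V)) :=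
  forall rho rho' : infseq V, mkseq rho n = mkseq rho' n -> X rho -> X rho'.

Definition cylinder : set (set (infseq V)) :=
  [set X | exists n, cylinder_at n X].

Lemma cylinder_at_le m n X : (m <= n)%N -> cylinder_at m X -> cylinder_at n X.
Proof.
move=> mn cX r r' e; apply: cX.
have tk (s : infseq V) : mkseq s m = take m (mkseq s n).
  by rewrite /mkseq -map_take take_iota (minn_idPl mn).
by rewrite !tk e.
Qed.

Lemma cylinder0 : cylinder set0.
Proof. by exists 0%N. Qed.

Lemma cylinder_atC n X : cylinder_at n X -> cylinder_at n (~` X).
Proof. by move=> cX r r' e Xr Xr'; apply: Xr; apply: cX Xr'. Qed.

Lemma cylinderC : setC_closed cylinder.
Proof. by move=> X [n /cylinder_atC cX]; exists n. Qed.

Lemma cylinder_common X Y : cylinder X -> cylinder Y ->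
  exists n, cylinder_at n X /\ cylinder_at n Y.
Proof.
move=> [m cX] [n cY]; exists (maxn m n); split.
  exact: cylinder_at_le (leq_maxl _ _) cX.
exact: cylinder_at_le (leq_maxr _ _) cY.
Qed.

Lemma cylinderU : setU_closed cylinder.
Proof.
move=> X Y cX cY; have [n [hX hY]] := cylinder_common cX cY; exists n.
by move=> r r' e [/(hX _ _ e)|/(hY _ _ e)]; [left|right].
Qed.

Lemma cylinder_atI n X Y :
  cylinder_at n X -> cylinder_at n Y -> cylinder_at n (X `&` Y).
Proof. by move=> hX hY r r' e [/(hX _ _ e) ? /(hY _ _ e)]. Qed.

HB.instance Definition _ := @isAlgebraOfSets.Build infseq_display (infseq V)
  cylinder cylinder0 cylinderU cylinderC.

Definition cyl (w : seq V) : set (infseq V) :=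
  [set rho | mkseq rho (size w) = w].

Lemma cylinder_at_cyl w : cylinder_at (size w) (cyl w).
Proof. by move=> r r' e; rewrite /cyl /= e. Qed.

End cylinders.

(* The law on infinite sequences of the process whose entry after the finite
   history h is drawn from K h: the extension to the sigma-algebra generated by
   the cylinders of the premeasure fixed by
   P (cyl [:: x_0; x_1; ...; x_n]) =
     K [::] x_0 * K [:: x_0] x_1 * ... * K [:: x_0; ...; x_(n-1)] x_n,
   see [path_measure_cyl]. *)
Section path_measure.
Variables (R : realType) (V : pointedType) (K : seq V -> dist R V).

Fixpoint path_prob (h w : seq V) : R :=
  if w is u :: w' then K h u * path_prob (rcons h u) w' else 1.

Let m w := path_prob [::] w.

Lemma path_prob_ge0 h w : 0 <= path_prob h w.
Proof. by elim: w h => //= u w ih h; rewrite mulr_ge0// dmass_ge0. Qed.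

Lemma path_prob_rcons h w u :
  path_prob h (rcons w u) = path_prob h w * K (h ++ w) u.
Proof.
elim: w h => [|x w ih] h /=; first by rewrite cats0 mulr1 mul1r.
by rewrite ih mulrA -cats1 -catA.
Qed.

Local Open Scope ereal_scope.

Let m_ge0 w : 0 <= (m w)%:E. Proof. by rewrite lee_fin path_prob_ge0. Qed.

Lemma esum_path_prob_rcons w : \esum_(u in [set: V]) (m (rcons w u))%:E = (m w)%:E.
Proof.
have [m0|m0] := eqVneq (m w) 0%R.
  rewrite m0; apply: esum1 => u _; rewrite /m path_prob_rcons.
  by rewrite -/(m w) m0 mul0r.
have mp : (0 < m w)%R by rewrite lt0r m0 path_prob_ge0.
have -> : (m w)%:E = (m w)%:E * \esum_(u in [set: V]) (K w u)%:E.
  by rewrite dmass_sum mule1.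
rewrite /esum -ereal_sup_pZl//; congr ereal_sup; apply/seteqP; split.
  move=> _ [A [finA _] <-]; exists (\sum_(u \in A) (K w u)%:E).
    by exists A.
  rewrite !fsbig_finite//= ge0_sume_distrr; last first.
    by move=> u _; rewrite lee_fin dmass_ge0.
  by apply: eq_bigr => u _; rewrite /m path_prob_rcons.
move=> _ [_ [A [finA _] <-] <-]; exists A => //.
rewrite !fsbig_finite//= ge0_sume_distrr; last first.
  by move=> u _; rewrite lee_fin dmass_ge0.
by apply: eq_bigr => u _; rewrite /m path_prob_rcons.
Qed.

Let lvl n (X : set (infseq V)) : \bar R :=
  \esum_(w in (fun rho => mkseq rho n) @` X) (m w)%:E.

Let mkseqS (r : infseq V) n : mkseq r n.+1 = rcons (mkseq r n) (r n).
Proof. exact: mkseqS. Qed.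

Let ext (w : seq V) (u : V) : infseq V := fun n => nth u w n.

Let ext_mkseq w u : mkseq (ext w u) (size w) = w.
Proof. exact: mkseq_nth. Qed.

Let lvlS n X : cylinder_at n X -> lvl n.+1 X = lvl n X.
Proof.
move=> cX; rewrite /lvl.
under [RHS]eq_esum do rewrite -esum_path_prob_rcons.
rewrite esum_esum//.
apply: (reindex_esum _ _ (fun k : seq V * V => rcons k.1 k.2)); split.
- move=> [w u] [/= [r Xr rw] _].
  have sw : size w = n by rewrite -rw size_mkseq.
  have E : mkseq (ext (rcons w u) u) n.+1 = rcons w u.
    by have := ext_mkseq (rcons w u) u; rewrite size_rcons sw.
  exists (ext (rcons w u) u) => //; apply: cX Xr; rewrite rw.
  by move: E; rewrite mkseqS => /rcons_inj [].
- by move=> [w u] [w' u'] _ _ /= /rcons_inj [-> ->].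
- move=> _ [r Xr <-]; exists (mkseq r n, r n); last by rewrite /= mkseqS.
  by split => //=; exists r.
Qed.

Let lvl_le n k X : cylinder_at n X -> (n <= k)%N -> lvl k X = lvl n X.
Proof.
move=> cX /subnK <-; elim: (k - n)%N => // j ih.
rewrite addSn lvlS//; apply: cylinder_at_le cX; exact: leq_addl.
Qed.

(* On a cylinder X any n with [cylinder_at n X] yields the same value. *)
Definition cylinder_prob (X : set (infseq V)) : \bar R :=
  \esum_(w in (fun rho => mkseq rho (xget 0%N [set n | cylinder_at n X])) @` X)
    (path_prob [::] w)%:E.

Lemma cylinder_probE n X : cylinder_at n X -> cylinder_prob X =
  \esum_(w in (fun rho => mkseq rho n) @` X) (path_prob [::] w)%:E.
Proof.
move=> cX; rewrite /cylinder_prob.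
case: xgetP => [k _ ck|/(_ n)]//.
have [kn|nk] := leqP k n; first by rewrite -/(lvl k X) -(lvl_le ck kn).
by rewrite -/(lvl k X) (lvl_le cX (ltnW nk)).
Qed.

Lemma cylinder_prob_ge0 X : 0 <= cylinder_prob X.
Proof. by apply: esum_ge0 => w _; exact: m_ge0. Qed.

Lemma cylinder_prob0 : cylinder_prob set0 = 0.
Proof. by rewrite (@cylinder_probE 0%N)// image_set0 esum_set0. Qed.

Lemma cylinder_prob_semi_additive : measure_function.semi_additive cylinder_prob.
Proof.
apply/(additive2P cylinder_prob0) => X Y cX cY XY0.
have [n [hX hY]] := cylinder_common cX cY.
have hXY : cylinder_at n (X `|` Y).
  by move=> r r' e [/(hX _ _ e)|/(hY _ _ e)]; [left|right].
rewrite !(cylinder_probE (n := n))// image_setU.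
rewrite (esumID ((fun rho : infseq V => mkseq rho n) @` X)); last first.
  by move=> w _; exact: m_ge0.
congr (_ + _); congr (esum _ _); apply/seteqP; split => [w []|w] //.
- by move=> Xw; split => //; left.
- by move=> [//|].
- move=> Yw; split; first by right.
  move=> [r Xr rw]; case: Yw => r' Yr' rw'.
  suff : (X `&` Y) r by rewrite XY0.
  by split => //; apply: hY Yr'; rewrite rw rw'.
Qed.

HB.instance Definition _ := isContent.Build infseq_display (infseq V) R
  cylinder_prob cylinder_prob_ge0 cylinder_prob_semi_additive.

Let cyl_rcons (w : seq V) (u : V) : cyl (rcons w u) `<=` cyl w.
Proof.
move=> r; rewrite /cyl /= size_rcons => e.
have := congr1 (take (size w)) e.
by rewrite -cats1 take_size_cat // /mkseq -map_take take_iota (minn_idPl (leqnSn _)).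
Qed.

Lemma cylinder_prob_split X w : cylinder X ->
  cylinder_prob (X `&` cyl w) =
  \esum_(u in [set: V]) cylinder_prob (X `&` cyl (rcons w u)).
Proof.
move=> [n cX]; pose N := maxn n (size w).+1.
have nN : (n <= N)%N by rewrite leq_maxl.
have wN : (size w < N)%N by rewrite leq_maxr.
have cXN := cylinder_at_le nN cX.
have cw : cylinder_at N (X `&` cyl w).
  by apply: cylinder_atI => //; exact: cylinder_at_le (ltnW wN) (cylinder_at_cyl (w := w)).
have cwu u : cylinder_at N (X `&` cyl (rcons w u)).
  apply: cylinder_atI => //.
  by apply: cylinder_at_le (cylinder_at_cyl (w := rcons w u)); rewrite size_rcons.
rewrite (cylinder_probE cw).
under [RHS]eq_esum do rewrite (cylinder_probE (cwu _)).
rewrite esum_esum; last by move=> *; exact: m_ge0.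
apply: (reindex_esum _ _ (fun k : V * seq V => k.2)); split.
- move=> [u x] [/= _ [r [Xr ru] rx]]; exists r => //; split => //.
  exact: cyl_rcons ru.
- move=> [u x] [u' x'] /[!inE] -[/= _ [r [Xr ru] rx]] [/= _ [r' [_ ru'] rx']] xx'.
  rewrite -xx'; congr (_, _).
  have e : mkseq r N = mkseq r' N by rewrite rx rx'.
  have := cylinder_at_le (n := N) _ (cylinder_at_cyl (w := rcons w u)).
  rewrite size_rcons => /(_ wN r r' e ru).
  by move: ru'; rewrite /cyl /= !size_rcons => -> /rcons_inj [].
- move=> x [r [Xr rw] <-]; exists (r (size w), mkseq r N) => //=.
  split => //=; exists r => //; split => //.
  by rewrite /cyl /= size_rcons mkseqS; congr rcons.
Qed.

Lemma cylinder_prob_le X Y : cylinder X -> cylinder Y -> X `<=` Y ->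
  cylinder_prob X <= cylinder_prob Y.
Proof. by move=> cX cY XY; apply: le_measure => //; rewrite inE. Qed.

Lemma cylinder_prob_sigma_subadditive :
  measurable_subset_sigma_subadditive cylinder_prob.
Proof.
move=> X F cF cX XF; rewrite leNgt; apply/negP => lt.
pose Q w := \sum_(k <oo) cylinder_prob (F k `&` cyl w) < cylinder_prob (X `&` cyl w).
have Q0 : Q [::].
  rewrite /Q; have -> : cyl [::] = [set: infseq V] by apply/seteqP.
  by rewrite setIT; under eq_eseriesr do rewrite setIT.
have Qstep w : Q w -> exists u, Q (rcons w u).
  move=> Qw; apply/not_existsP => nQ; move: Qw; apply/negP; rewrite -leNgt.
  rewrite cylinder_prob_split// nneseries_esumT; last first.
    by move=> k; exact: cylinder_prob_ge0.
  rewrite (eq_esum (fun k _ => cylinder_prob_split w (cF k))).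
  rewrite esum_esum; last by move=> *; exact: cylinder_prob_ge0.
  rewrite (reindex_esum ([set: V] `*`` (fun=> [set: nat])) _
     (fun k : V * nat => (k.2, k.1))); last first.
    split => [[]|[? ?] [? ?] _ _ [-> ->]|[a b] _]//.
    by exists (b, a).
  rewrite -(esum_esum (a := fun u k => cylinder_prob (F k `&` cyl (rcons w u)))); last first.
    by move=> *; exact: cylinder_prob_ge0.
  apply: le_esum => u _; rewrite -nneseries_esumT; last first.
    by move=> *; exact: cylinder_prob_ge0.
  by rewrite leNgt; apply/negP; exact: nQ.
have /choice[nxt Qnxt] : forall w, exists u, Q w -> Q (rcons w u).
  move=> w; have [/Qstep[u Qu]|nQ] := pselect (Q w); first by exists u.
  by exists point.
pose ws n := iter n (fun w => rcons w (nxt w)) [::].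
pose r : infseq V := fun n => nxt (ws n).
have Qws n : Q (ws n) by elim: n => //= n /Qnxt.
have rws n : mkseq r n = ws n by elim: n => //= n ih; rewrite mkseqS ih.
have Xr : X r.
  have [n cXn] := cX.
  have : 0 < cylinder_prob (X `&` cyl (ws n)).
    apply: le_lt_trans (Qws n); apply: nneseries_ge0 => *.
    exact: cylinder_prob_ge0.
  have [->|/set0P[r' [Xr' wr']] _] := eqVneq (X `&` cyl (ws n)) set0.
    by rewrite cylinder_prob0 ltxx.
  apply: cXn Xr'; rewrite rws; move: wr'.
  by rewrite /cyl /= -rws size_mkseq.
have [k _ Fr] := XF _ Xr.
have [n cFn] := cF k.
have sub : X `&` cyl (ws n) `<=` F k `&` cyl (ws n).
  move=> r' [_ wr']; split => //; apply: cFn Fr; rewrite rws -wr'.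
  by rewrite -rws size_mkseq.
have cw : cylinder (cyl (ws n)) by exists (size (ws n)); exact: cylinder_at_cyl.
have := Qws n; apply/negP; rewrite -leNgt.
apply: (@le_trans _ _ (cylinder_prob (F k `&` cyl (ws n)))).
  by apply: cylinder_prob_le => //; apply: (@measurableI infseq_display (infseq V)).
rewrite nneseries_esumT; last by move=> *; exact: cylinder_prob_ge0.
rewrite -(esum_set1 (t := k) (a := fun k => cylinder_prob (F k `&` cyl (ws n)))); last first.
  exact: cylinder_prob_ge0.
rewrite esum_mkcond; apply: le_esum => j _; case: ifP => // _.
Qed.

HB.instance Definition _ := Content_SigmaSubAdditive_isMeasure.Build
  infseq_display R (infseq V) cylinder_prob cylinder_prob_sigma_subadditive.

Definition path_measure :
    set (g_sigma_algebraType (@measurable _ (infseq V))) -> \bar R :=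
  measure_extension cylinder_prob.

HB.instance Definition _ := Measure.on path_measure.

Lemma path_measure_cylinder X : cylinder X -> path_measure X = cylinder_prob X.
Proof. by move=> cX; rewrite /path_measure /measure_extension measurable_mu_extE. Qed.

Lemma path_measure_cyl w : path_measure (cyl w) = (path_prob [::] w)%:E.
Proof.
have cw := cylinder_at_cyl (w := w).
rewrite path_measure_cylinder; last by exists (size w).
rewrite (cylinder_probE cw).
have -> : [set mkseq r (size w) | r in cyl w] = [set w].
  apply/seteqP; split => [x [r rw <-]//|x ->].
  by exists (ext w point); rewrite /cyl /= ext_mkseq.
by rewrite esum_set1//; exact: m_ge0.
Qed.

Lemma path_measure_setT : path_measure setT = 1.
Proof.
have -> : [set: infseq V] = cyl [::] by apply/seteqP.
by rewrite path_measure_cyl.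
Qed.

HB.instance Definition _ := Measure_isProbability.Build _ _ _
  path_measure path_measure_setT.

End path_measure.

Inductive player := P1 | P2.

Notation Refuter := P1 (only parsing).
Notation Verifier := P2 (only parsing).

Definition opponent (i : player) : player := if i is P1 then P2 else P1.

(* [owner v] is [Some P1], [Some P2] or [None] as v lies in V_1, V_2 or V_P;
   the value of [delta] outside V_P is irrelevant.  [vertex] is pointed because
   measurable types are; the point carries no meaning. *)
Record game_graph (R : realType) := GameGraph {
  vertex :> pointedType ;
  edge : vertex -> vertex -> Prop ;
  owner : vertex -> option player ;
  initial : vertex ;
  delta : vertex -> dist R vertex ;
  delta_edge : forall v, owner v = None ->
    forall u, edge v u <-> 0 < delta v u }.

(* [choice_at h v] is the value of the strategy on the finite sequence h v; it
   is unconstrained, and never used, when v does not belong to the player. *)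
Record strategy (R : realType) (G : game_graph R) (i : player) := Strategy {
  choice_at :> seq G -> G -> dist R G ;
  choice_at_edge : forall h v u,
    owner v = Some i -> 0 < choice_at h v u -> edge v u }.

Section games.
Variables (R : realType) (G : game_graph R).

Definition plays : set (infseq G) :=
  [set rho | forall k, edge (rho k) (rho k.+1)].

Definition reach (X : set G) : set (infseq G) :=
  [set rho | plays rho /\ exists k, X (rho k)].

Definition avoid (X : set G) : set (infseq G) := plays `\` reach X.

Section outcomes.
Variables (i : player) (sigma : strategy G i) (tau : strategy G (opponent i)).
Variable v : G.

Definition step (h : seq G) (u : G) : dist R G :=
  match owner u, i with
  | None, _ => delta u
  | Some P1, P1 | Some P2, P2 => sigma h u
  | Some _, _ => tau h u
  end.

(* The Markov chain started in v, on histories: the empty history is followed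
   by v, a history h u by a vertex drawn from [step h u]. *)
Definition chain (h : seq G) : dist R G :=
  if h is x :: t then step (belast x t) (last x t) else ddirac v.

Definition possible_plays : set (infseq G) :=
  [set rho | forall n, 0 < chain (mkseq rho n) (rho n)].

End outcomes.

Definition sure_winning i (sigma : strategy G i) (v : G)
    (Phi : set (infseq G)) :=
  forall tau : strategy G (opponent i), possible_plays sigma tau v `<=` Phi.

Definition almost_sure_winning i (sigma : strategy G i) (v : G)
    (Phi : set (infseq G)) :=
  forall tau : strategy G (opponent i),
    path_measure (chain sigma tau v) Phi = 1%E.

Lemma measurable_avoid (X : set G) :
  measurable (avoid X : set (g_sigma_algebraType (@measurable _ (infseq G)))).
Proof.
have -> : avoid X = \bigcap_n [set rho : infseq G |
    edge (rho n) (rho n.+1) /\ ~ X (rho n)].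
  apply/seteqP; split => [rho [pl nr] n _|rho h].
    by split => // Xn; apply: nr; split => //; exists n.
  split => [k|[_ [k Xk]]]; first by have [] := h k I.
  by have [] := h k I.
apply: bigcapT_measurable => n; apply: sub_sigma_algebra.
exists n.+2 => r r' e.
have ek k : (k < n.+2)%N -> r k = r' k.
  by move=> kn; have := congr1 (nth point ^~ k) e; rewrite !nth_mkseq.
by rewrite /= !ek.
Qed.

End games.

Section couplings.
Variables (R : realType) (S S' : finType).

Definition coupling (mu : dist R S) (mu' : dist R S')
    (w : dist R (S * S')%type) :=
  (forall t, \sum_(t' : S') w (t, t') = mu t) /\
  (forall t', \sum_(t : S) w (t, t') = mu' t').

Definition lifting (M : S -> S' -> Prop) (mu : dist R S) (mu' : dist R S') :=
  exists w, coupling mu mu' w /\ forall t t', 0 < w (t, t') -> M t t'.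

End couplings.

Record pts (R : realType) (S L : finType) := Pts {
  trans : S -> L -> dist R S -> Prop ;
  init : S ;
  trans_finite :
    finite_set [set x : S * L * dist R S | trans x.1.1 x.1.2 x.2] ;
  trans_total : forall s, exists a mu, trans s a mu }.

(* The alphabet of the implementation is the disjoint union of the actions
   (tagged [inl]) and of the faults (tagged [inr]). *)
Section masking.
Variables (R : realType) (S S' Act Flt : finType).
Variables (A : pts R S Act) (A' : pts R S' (Act + Flt)%type).

Definition masking_simulation (M : S -> S' -> Prop) :=
  M (init A) (init A') /\
  forall s s', M s s' ->
  [/\ forall e mu, trans A s e mu ->
        exists mu', trans A' s' (inl e) mu' /\ lifting M mu mu',
      forall e mu', trans A' s' (inl e) mu' ->
        exists mu, trans A s e mu /\ lifting M mu mu'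
    & forall F mu', trans A' s' (inr F) mu' -> lifting M (ddirac s) mu'].

Definition masks := exists M, masking_simulation M.

Definition matching s s' (mu : dist R S) (mu' : dist R S') :=
  exists l : Act + Flt,
    match l with inl a => trans A s a mu | inr _ => mu = ddirac s end /\
    trans A' s' l mu'.

Inductive masking_vertex :=
| Err
| VR (s : S) (s' : S')
| VV1 (s : S) (a : Act) (s' : S') (mu : dist R S) of trans A s a mu
| VV2 (s : S) (l : Act + Flt) (s' : S') (mu' : dist R S') of trans A' s' l mu'
| VP (s : S) (s' : S') (mu : dist R S) (mu' : dist R S')
     (w : dist R (S * S')%type) of coupling mu mu' w & matching s s' mu mu'.

HB.instance Definition _ := gen_eqMixin masking_vertex.
HB.instance Definition _ := gen_choiceMixin masking_vertex.
HB.instance Definition _ := isPointed.Build masking_vertex Err.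

Definition masking_owner (x : masking_vertex) : option player :=
  match x with
  | Err | VR _ _ => Some Refuter
  | VV1 _ _ _ _ _ | VV2 _ _ _ _ _ => Some Verifier
  | VP _ _ _ _ _ _ _ => None
  end.

(* All edges but those into [Err]; the transitions chosen by the Refuter and
   the coupling condition are part of the target vertices. *)
Definition masking_move (x y : masking_vertex) : Prop :=
  match x, y with
  | VR s s', VV1 t _ t' _ _ => t = s /\ t' = s'
  | VR s s', VV2 t _ t' _ _ => t = s /\ t' = s'
  | VV1 s a s' mu _, VP t t' nu nu' _ _ _ =>
      [/\ t = s, t' = s', nu = mu & trans A' s' (inl a) nu']
  | VV2 s (inl a) s' mu' _, VP t t' nu nu' _ _ _ =>
      [/\ t = s, t' = s', nu' = mu' & trans A s a nu]
  | VV2 s (inr _) s' mu' _, VP t t' nu nu' _ _ _ =>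
      [/\ t = s, t' = s', nu' = mu' & nu = ddirac s]
  | VP _ _ _ _ w _ _, VR t t' => 0 < w (t, t')
  | _, _ => False
  end.

Definition masking_edge (x y : masking_vertex) : Prop :=
  masking_move x y \/
  [/\ y = Err, masking_owner x = Some Verifier \/ x = Err
    & forall z, ~ masking_move x z].

Section vertex_dist.
Variable w : dist R (S * S')%type.

Definition vertex_mass (y : masking_vertex) : R :=
  if y is VR t t' then w (t, t') else 0.

Lemma vertex_mass_ge0 y : 0 <= vertex_mass y.
Proof. by case: y => //= *; exact: dmass_ge0. Qed.

Lemma vertex_mass_sum :
  (\esum_(y in [set: masking_vertex]) (vertex_mass y)%:E = 1)%E.
Proof.
rewrite (esumID [set VR p.1 p.2 | p in [set: S * S']]); last first.
  by move=> y _; rewrite lee_fin vertex_mass_ge0.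
rewrite setTI esum_image; last by move=> [? ?] [? ?] _ _ [-> ->].
rewrite [X in (_ + X)%E]esum1 ?adde0.
  rewrite -[RHS](dmass_sum w); apply: eq_esum => -[t t'] _ //.
move=> [|s s'|||] //= [_ nr]; exfalso; apply: nr; by exists (s, s').
Qed.

Definition vertex_dist : dist R masking_vertex :=
  Dist vertex_mass_ge0 vertex_mass_sum.

End vertex_dist.

Definition masking_delta (x : masking_vertex) : dist R masking_vertex :=
  if x is VP _ _ _ _ w _ _ then vertex_dist w else ddirac x.

Lemma masking_delta_edge x : masking_owner x = None ->
  forall y, masking_edge x y <-> 0 < masking_delta x y.
Proof.
case: x => // s s' mu mu' w cw mt _ y; rewrite /masking_edge /=; split.
  by move=> [|[_ [|]]//]; case: y.
by case: y => //=; rewrite ?ltxx// => t t' wt; left.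
Qed.

Definition masking_game : game_graph R :=
  @GameGraph R masking_vertex masking_edge masking_owner
    (VR (init A) (init A')) masking_delta masking_delta_edge.

Definition verr : masking_game := Err.

End masking.

(* Main.v *)
Require Import Defs.
From mathcomp Require Import all_boot all_order all_algebra.
From mathcomp Require Import all_classical all_reals all_analysis.
Set Implicit Arguments.
Unset Strict Implicit.
Unset Printing Implicit Defensive.
Import Order.TTheory GRing.Theory Num.Theory.
Local Open Scope classical_set_scope.
Local Open Scope ring_scope.

(** Given a masking simulation M, the Verifier answers every move with a coupling
    supported in M, which keeps all possible plays inside M and away from the
    error vertex. A sure winning strategy is almost-sure winning because every
    prefix of positive probability extends to a possible play, so that each bad
    cylinder is null. Conversely, fix an almost-sure winning strategy sigma and
    relate s to s' when some history ending in [VR s s'] has positive probability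
    against some Refuter strategy: this relation is a masking simulation. *)

(** * Points of positive mass in discrete distributions *)

Lemma dist_exists_pos (R : realType) (T : choiceType) (d : dist R T) :
  exists x, 0 < d x.
Proof.
apply: contrapT => /forallNP d0; have := dmass_sum d.
rewrite esum1 => [/eqP|x _]; first by rewrite eq_sym onee_eq0.
by congr EFin; apply/eqP; rewrite eq_le dmass_ge0 andbT leNgt; apply/negP.
Qed.

Lemma ddirac_gt0 (R : realType) (T : choiceType) (x y : T) :
  0 < ddirac (R := R) x y -> y = x.
Proof. by rewrite /=; case: eqVneq => //; rewrite ltxx. Qed.

Lemma ddirac_id_gt0 (R : realType) (T : choiceType) (x : T) :
  0 < ddirac (R := R) x x.
Proof. by rewrite /= eqxx ltr01. Qed.

(** * Histories of positive weight and their cylinders *)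

Section paths.
Variables (R : realType) (V : pointedType).
Implicit Types (K : seq V -> dist R V) (w : seq V) (rho : infseq V).

Lemma path_prob_rcons_gt0 K w u :
  (0 < path_prob K [::] (rcons w u)) = (0 < path_prob K [::] w) && (0 < K w u).
Proof.
rewrite path_prob_rcons cat0s !lt0r mulf_eq0 negb_or.
by rewrite mulr_ge0 ?path_prob_ge0 ?dmass_ge0// !andbT.
Qed.

(** The weight of [w] is a product of values of the kernel at proper prefixes of [w]. *)
Lemma eq_path_prob K K' w :
  (forall h, (size h < size w)%N -> K h = K' h) ->
  path_prob K [::] w = path_prob K' [::] w.
Proof.
elim/last_ind: w => // w u ih KK'; rewrite !path_prob_rcons !cat0s ih.
  by rewrite KK'// size_rcons.
by move=> h hw; rewrite KK'// size_rcons ltnW.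
Qed.

(** Every distribution has a point of positive mass, so [w] can be continued forever, one entry at a
    time. *)
Lemma path_prob_extend K w : 0 < path_prob K [::] w ->
  exists2 rho, mkseq rho (size w) = w & forall n, 0 < K (mkseq rho n) (rho n).
Proof.
move=> w0; have [nxt nxtP] := choice (fun h => dist_exists_pos (K h)).
pose ext n := iter n (fun h => rcons h (nxt h)) w.
have size_ext n : size (ext n) = (size w + n)%N.
  by elim: n => [|n ih]; rewrite ?addn0//= size_rcons ih addnS.
have ext_gt0 n : 0 < path_prob K [::] (ext n).
  by elim: n => //= n ih; rewrite path_prob_rcons_gt0 ih nxtP.
have nth_ext m k : (k < size w + m)%N -> forall j,
    nth point (ext (m + j)%N) k = nth point (ext m) k.
  move=> km; elim=> [|j ih]; first by rewrite addn0.
  rewrite addnS /= nth_rcons size_ext ih.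
  by rewrite (leq_trans km)// leq_add2l leq_addr.
(* Index [n] is read in [ext n.+1] because [ext n] is too short when [w] is empty; the default
   [point] never occurs. *)
pose rho : infseq V := fun n => nth point (ext n.+1) n.
have rhoE n : mkseq rho (size w + n) = ext n.
  apply: (@eq_from_nth _ point); rewrite size_mkseq ?size_ext// => k kn.
  rewrite nth_mkseq// /rho.
  have kk : (k < size w + k.+1)%N by rewrite addnS ltnS leq_addl.
  by rewrite -(nth_ext _ _ kk n) -(nth_ext _ _ kn k.+1) addnC.
exists rho => [|n]; first by rewrite -[size w]addn0 rhoE.
have pos m : 0 < path_prob K [::] (mkseq rho (size w + m)) by rewrite rhoE.
(* Position [n] may lie inside [w], so positivity is carried from long prefixes down to shorter
   ones. *)
suff prefix_gt0 k m : 0 < path_prob K [::] (mkseq rho (k + m)) ->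
    0 < path_prob K [::] (mkseq rho k).
  have := pos n.+1; rewrite addnC => /prefix_gt0.
  by rewrite mkseqS path_prob_rcons_gt0 => /andP[].
elim: m => [|m ih]; first by rewrite addn0.
by rewrite addnS mkseqS path_prob_rcons_gt0 => /andP[/ih].
Qed.

Lemma path_measure_setC K (X : set (infseq V)) :
  measurable (X : set (g_sigma_algebraType (@measurable _ (infseq V)))) ->
  path_measure K (~` X) = (1 - path_measure K X)%E.
Proof. exact: (probability_setC (path_measure K)). Qed.

(** The measure is a sum of weights of prefixes of length [n]. A prefix of positive weight would
    extend to a possible sequence, which lies in [X] by agreement on the first [n] entries. *)
Lemma cylinder_at_null K n (X : set (infseq V)) : cylinder_at n X ->
  (forall rho, (forall k, 0 < K (mkseq rho k) (rho k)) -> ~ X rho) ->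
  path_measure K X = 0%E.
Proof.
move=> cX nX; rewrite path_measure_cylinder; last by exists n.
rewrite (cylinder_probE _ cX); apply: esum1 => w [r Xr rw].
congr EFin; apply/eqP; rewrite eq_le path_prob_ge0 andbT leNgt; apply/negP.
move=> /path_prob_extend[rho rhow] /nX; apply; apply: cX Xr.
by rewrite rw -rhow -rw size_mkseq.
Qed.

End paths.

(** * Strategies, invariants and reachable histories in arbitrary game graphs *)

Section games.
Variables (R : realType) (G : game_graph R).
Implicit Types (v u : G) (h : seq G).

Lemma positional_strategy i (f : G -> G) :
  (forall v, owner v = Some i -> edge v (f v)) ->
  exists sigma : strategy G i, forall h v, sigma h v = ddirac (f v).
Proof.
move=> fE.
have fS h v u : owner v = Some i -> 0 < ddirac (R := R) (f v) u -> edge v u.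
  by move=> /fE ? /ddirac_gt0 ->.
by exists (Strategy fS).
Qed.

Lemma deviating_strategy i (tau : strategy G i) h v u : edge v u ->
  exists tau' : strategy G i, tau' h v = ddirac u /\
    forall h' v', (size h' < size h)%N -> tau' h' v' = tau h' v'.
Proof.
move=> vu; pose c h' v' := if (h', v') == (h, v) then ddirac u else tau h' v'.
have cS h' v' u' : owner v' = Some i -> 0 < c h' v' u' -> edge v' u'.
  rewrite /c; case: eqP => [[_ ->] _ /ddirac_gt0 -> //|_].
  exact: choice_at_edge.
exists (Strategy cS); split => [|h' v' hh]; rewrite /= /c ?eqxx//.
by case: eqP => // -[hE _]; rewrite hE ltnn in hh.
Qed.

Section outcomes.
Variables (i : player) (sigma : strategy G i).
Implicit Types tau : strategy G (opponent i).

Lemma step_own tau h v : owner v = Some i -> step sigma tau h v = sigma h v.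
Proof. by rewrite /step => ->; case: i sigma tau. Qed.

Lemma step_opponent tau h v :
  owner v = Some (opponent i) -> step sigma tau h v = tau h v.
Proof. by rewrite /step => ->; case: i sigma tau. Qed.

Lemma step_chance tau h v : owner v = None -> step sigma tau h v = delta v.
Proof. by rewrite /step => ->. Qed.

Lemma owner_cases v :
  [\/ owner v = Some i, owner v = Some (opponent i) | owner v = None].
Proof.
by case: (owner v) i => [[]|] []; (exact: Or31 || exact: Or32 || exact: Or33).
Qed.

Lemma step_edge tau h v u : 0 < step sigma tau h v u -> edge v u.
Proof.
have [vo|vo|vo] := owner_cases v.
- by rewrite step_own//; exact: choice_at_edge.
- by rewrite step_opponent//; exact: choice_at_edge.
- by rewrite step_chance// => /(delta_edge vo).
Qed.

Lemma chain_rcons tau v0 h v :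
  chain sigma tau v0 (rcons h v) = step sigma tau h v.
Proof. by case: h => //= x h; rewrite belast_rcons last_rcons. Qed.

Lemma possible_play_start tau v0 rho :
  possible_plays sigma tau v0 rho -> rho 0%N = v0.
Proof. by move=> /(_ 0%N) /ddirac_gt0. Qed.

Lemma possible_play_step tau v0 rho n : possible_plays sigma tau v0 rho ->
  0 < step sigma tau (mkseq rho n) (rho n) (rho n.+1).
Proof. by move=> /(_ n.+1); rewrite mkseqS chain_rcons. Qed.

(** Induction along a possible play: opponent and chance are both treated as following arbitrary
    edges, and only the player's own steps use the support of [sigma]. *)
Lemma sure_winning_invariant (good X : set G) v0 :
  good v0 -> (forall v, good v -> ~ X v) ->
  (forall h v u, owner v = Some i -> good v -> 0 < sigma h v u -> good u) ->
  (forall v u, owner v <> Some i -> good v -> edge v u -> good u) ->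
  sure_winning sigma v0 (avoid X).
Proof.
move=> g0 gX gown gedge tau rho pos.
have good_rho n : good (rho n).
  elim: n => [|n ih]; first by rewrite (possible_play_start pos).
  have := possible_play_step n pos.
  have [vo|vo|vo] := owner_cases (rho n).
  - by rewrite step_own//; exact: gown.
  - move=> /step_edge; apply: gedge => //; rewrite vo.
    by case: (i).
  - by move=> /step_edge; apply: gedge => //; rewrite vo.
split => [n|[_ [n]]]; last exact: gX.
exact: step_edge (possible_play_step n pos).
Qed.

Lemma sure_almost_sure_avoid v0 (X : set G) :
  sure_winning sigma v0 (avoid X) -> almost_sure_winning sigma v0 (avoid X).
Proof.
move=> win tau; set P := path_measure _.
(* [B n] collects the sequences that fail at time [n], by a missing edge or a visit to [X]. It reads
   entries [n] and [n.+1], hence the level [n.+2]. *)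
pose B n := [set rho : infseq G | ~ (edge (rho n) (rho n.+1) /\ ~ X (rho n))].
have cB n : cylinder_at n.+2 (B n).
  move=> r r' e.
  have ek k : (k < n.+2)%N -> r k = r' k.
    by move=> kn; have := congr1 (nth point ^~ k) e; rewrite !nth_mkseq.
  by rewrite /B /= !ek.
have B0 n : P (B n) = 0%E.
  apply: (cylinder_at_null (cB n)) => rho /win[pl nr]; apply; split => // Xn.
  by apply: nr; split => //; exists n.
have mB n : measurable (B n : set (g_sigma_algebraType (@measurable _ (infseq G)))).
  by apply: sub_sigma_algebra; exists n.+2.
have mA := measurable_avoid (G := G) X.
(* Countably many null cylinders cover every failure, including sequences that are not plays. *)
have bad : ~` avoid X = \bigcup_n B n.
  apply/seteqP; split => [rho nA|rho [n _ Bn] [pl nr]].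
    apply: contrapT => nB; apply: nA.
    have ok n : edge (rho n) (rho n.+1) /\ ~ X (rho n).
      by apply: contrapT => ?; apply: nB; exists n.
    by split => [n|[_ [n Xn]]]; have [] := ok n.
  by apply: Bn; split => // Xn; apply: nr; split => //; exists n.
have : P (~` avoid X) = 0%E.
  rewrite bad; apply/negligibleP; first exact: bigcupT_measurable.
  by apply: negligible_bigcup => n; apply/negligibleP => //; exact: B0.
move=> bad0; have := path_measure_setC (chain sigma tau v0) (measurableC mA).
by rewrite setCK -/P bad0 sube0.
Qed.

(** The opponent may differ from one history to another while [sigma] stays fixed; this makes the
    reachable histories closed under every opponent edge. *)
Definition reachable v0 (w : seq G) :=
  exists tau, 0 < path_prob (chain sigma tau v0) [::] w.

(** The argument [tau] is a real demand: a graph with dead ends may admit no opponent strategy. *)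
Lemma reachable_initial v0 (tau : strategy G (opponent i)) :
  reachable v0 [:: v0].
Proof. by exists tau; rewrite /= eqxx mulr1 ltr01. Qed.

Lemma reachable_own v0 h v u : owner v = Some i ->
  reachable v0 (rcons h v) -> 0 < sigma h v u ->
  reachable v0 (rcons (rcons h v) u).
Proof.
move=> vo [tau hv] vu; exists tau.
by rewrite path_prob_rcons_gt0 hv chain_rcons step_own.
Qed.

Lemma reachable_chance v0 h v u : owner v = None ->
  reachable v0 (rcons h v) -> edge v u ->
  reachable v0 (rcons (rcons h v) u).
Proof.
move=> vo [tau hv] /(delta_edge vo) vu; exists tau.
by rewrite path_prob_rcons_gt0 hv chain_rcons step_chance.
Qed.

(* The opponent may switch to [u] after the history [h v]: this does not affect
   the probability of reaching that history. *)
Lemma reachable_opponent v0 h v u : owner v = Some (opponent i) ->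
  reachable v0 (rcons h v) -> edge v u ->
  reachable v0 (rcons (rcons h v) u).
Proof.
move=> vo [tau hv] vu.
have [tau' [tau'hv tau'E]] := deviating_strategy tau h vu.
exists tau'; rewrite path_prob_rcons_gt0 chain_rcons step_opponent// tau'hv.
rewrite ddirac_id_gt0 andbT.
(* At proper prefixes of [rcons h v] the strategies are consulted only after histories shorter than
   [h], where they agree. *)
rewrite (@eq_path_prob _ _ _ (chain sigma tau v0))// => h'.
elim/last_ind: h' => // h' v' _; rewrite !size_rcons ltnS !chain_rcons => hh.
have [v'o|v'o|v'o] := owner_cases v'.
- by rewrite !step_own.
- by rewrite !step_opponent// tau'E.
- by rewrite !step_chance.
Qed.

(** Otherwise the cylinder of the history would have positive measure inside the null complement of
    [avoid X]. *)
Lemma almost_sure_reachable v0 (X : set G) h v :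
  almost_sure_winning sigma v0 (avoid X) ->
  reachable v0 (rcons h v) -> ~ X v.
Proof.
move=> win [tau hv] Xv; set P := path_measure (chain sigma tau v0).
have mA := measurable_avoid (G := G) X.
have : (P (cyl (rcons h v)) <= P (~` avoid X))%E.
  apply: le_measure; rewrite ?inE.
  - apply: sub_sigma_algebra; exists (size (rcons h v)).
    exact: cylinder_at_cyl.
  - exact: measurableC.
  - move=> rho rhov [pl nr]; apply: nr; split => //; exists (size h).
    move: rhov; rewrite /cyl /= size_rcons mkseqS => /rcons_inj[_ ->].
    exact: Xv.
rewrite /P path_measure_setC// win subee// path_measure_cyl lee_fin.
by rewrite leNgt hv.
Qed.

End outcomes.
End games.

(** * Masking simulations and the masking game *)

Section masking.
Variables (R : realType) (S S' Act Flt : finType).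
Variables (A : pts R S Act) (A' : pts R S' (Act + Flt)%type).
Let G := masking_game A A'.

(** This makes strategies available. Refuter vertices use totality of [A], probabilistic ones the
    nonempty support of [w], the others fall back on [Err]. *)
Lemma masking_edge_exists (v : G) : exists u, edge v u.
Proof.
have [[u vu]|nm] := pselect (exists u, masking_move v u).
  by exists u; left.
have noM u : ~ masking_move v u by move=> vu; apply: nm; exists u.
case: v nm noM => [|s s'|s a s' mu tr|s l s' mu' tr|s s' mu mu' w cw mt] nm noM.
- by exists (Err A A'); right; split => //; right.
- have [a [mu tr]] := trans_total A s.
  by case: (noM (VV1 A' s' tr)).
- by exists (Err A A'); right; split => //; left.
- by exists (Err A A'); right; split => //; left.
- have [[t t'] wt] := dist_exists_pos w.
  by case: (noM (VR A A' t t')).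
Qed.

Lemma masks_sure_winning : masks A A' ->
  exists sigma : strategy G Verifier,
    sure_winning sigma (initial G) (avoid [set verr A A']).
Proof.
move=> [M [M0 simM]].
(* At a probabilistic vertex the invariant constrains the support of the coupling, where the next
   state pair is drawn. *)
pose good (v : G) := match v with
  | Err => False
  | VR s s' | VV1 s _ s' _ _ | VV2 s _ s' _ _ => M s s'
  | VP _ _ _ _ w _ _ => forall t t', 0 < w (t, t') -> M t t'
  end.
(* The simulation clauses supply the answer at good Verifier vertices; elsewhere any successor will
   do. *)
have /choice[f fP] : forall v : G, exists u,
    edge v u /\ (owner v = Some Verifier -> good v -> good u).
  move=> v; have [[vo gv]|ng] := pselect (owner v = Some Verifier /\ good v).
    suff [u [mu gu]] : exists u, masking_move v u /\ good u.
      by exists u; split => //; left.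
    case: v vo gv => //= [s a s' mu tr|s [a|F] s' mu' tr] _ /simM[sim1 sim2 sim3].
    - have [mu' [tr' [w [cw wM]]]] := sim1 _ _ tr.
      have mt : matching A A' s s' mu mu' by exists (inl a).
      by exists (VP cw mt).
    - have [mu [tr' [w [cw wM]]]] := sim2 _ _ tr.
      have mt : matching A A' s s' mu mu' by exists (inl a).
      by exists (VP cw mt).
    - have [w [cw wM]] := sim3 _ _ tr.
      have mt : matching A A' s s' (ddirac s) mu' by exists (inr F).
      by exists (VP cw mt).
  have [u vu] := masking_edge_exists v.
  by exists u; split => // vo gv; case: ng.
have [sigma sigmaE] : exists sigma : strategy G Verifier,
    forall h v, sigma h v = ddirac (f v).
  by apply: positional_strategy => v _; have [] := fP v.
exists sigma; apply: (@sure_winning_invariant _ _ _ _ good) => //.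
- by move=> v gv vE; rewrite vE in gv.
- move=> h v u vo gv; rewrite sigmaE => /ddirac_gt0 ->.
  by have [_] := fP v; apply.
(* Refuter moves keep the state pair, chance moves land in the support of [w], and neither kind of
   vertex has an edge to [Err]. *)
- move=> v u; case: v => [||||] //=.
  + move=> s s' _ Mss' [|[_ [|]]//].
    by case: u => //= [t a t' mu tr|t l t' mu' tr] [-> ->].
  + move=> s s' mu mu' w cw mt _ wM [|[_ [|]]//].
    by case: u => //= t t'; exact: wM.
Qed.

(* The Refuter can deviate after the reached history to any transition of [s] or
   [s'], and any answer to which sigma gives positive probability carries the
   coupling required by masking. *)
Lemma almost_sure_winning_masks (sigma : strategy G Verifier) :
  almost_sure_winning sigma (initial G) (avoid [set verr A A']) -> masks A A'.
Proof.
move=> win; pose reach w := reachable sigma (initial G) w.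
have [f fP] := choice masking_edge_exists.
(* Some Refuter strategy must exist for the initial vertex to count as reachable. *)
have [tau _] : exists tau : strategy G Refuter,
    forall h v, tau h v = ddirac (f v).
  by apply: positional_strategy => v _; exact: fP.
exists (fun s s' => exists h, reach (rcons h (VR A A' s s'))); split.
  by exists [::]; exact: (@reachable_initial _ _ Verifier sigma (initial G) tau).
have answer h s s' (v : G) : reach (rcons h (VR A A' s s')) ->
    edge (VR A A' s s' : G) v -> owner v = Some Verifier ->
    exists t t' mu mu' w (cw : coupling mu mu' w)
           (mt : matching A A' t t' mu mu'),
      masking_move v (VP cw mt) /\
      forall r r', 0 < w (r, r') -> exists h', reach (rcons h' (VR A A' r r')).
  move=> hs sv vo.
  have so : owner (VR A A' s s' : G) = Some (opponent Verifier) by [].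
  have hv := reachable_opponent so hs sv.
  have [u vu] := dist_exists_pos (sigma (rcons h (VR A A' s s')) v).
  have hu := reachable_own vo hv vu.
  (* With [Err] excluded, the edge to [u] is a proper move, whose target is a probabilistic
     vertex. *)
  have uE : u <> Err A A' by exact: almost_sure_reachable win hu.
  have [|[//]] := choice_at_edge vo vu.
  case: u uE vu hu =>
    [|? ?|? ? ? ? ?|? ? ? ? ?|t t' mu mu' w cw mt] // _ vu hu mv.
  1-3: by move: vo mv; case: (v) => //= ? [].
  exists t, t', mu, mu', w, cw, mt; split => // r r' wr.
  exists (rcons (rcons (rcons h (VR A A' s s')) v) (VP cw mt)).
  by apply: reachable_chance hu _ => //; left.
move=> s s' [h hs]; split => [e mu tr|e mu' tr|F mu' tr].
- have [||t [t' [nu [nu' [w [cw [mt [/= mv wM]]]]]]]] :=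
    answer h s s' (VV1 A' s' tr : G) hs; [by left|by []|].
  case: mv cw => _ _ -> tr' cw.
  by exists nu'; split => //; exists w.
- have [||t [t' [nu [nu' [w [cw [mt [/= mv wM]]]]]]]] :=
    answer h s s' (VV2 A s tr : G) hs; [by left|by []|].
  case: mv cw => _ _ -> tr' cw.
  by exists nu; split => //; exists w.
- have [||t [t' [nu [nu' [w [cw [mt [/= mv wM]]]]]]]] :=
    answer h s s' (VV2 A s tr : G) hs; [by left|by []|].
  case: mv cw => _ _ -> -> cw.
  by exists w.
Qed.

End masking.

Theorem theorem1 (R : realType) (S S' Act Flt : finType)
    (A : pts R S Act) (A' : pts R S' (Act + Flt)%type) :
  (masks A A' <->
   exists sigma : strategy (masking_game A A') Verifier,
     sure_winning sigma (initial (masking_game A A'))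
       (avoid [set verr A A'])) /\
  (masks A A' <->
   exists sigma : strategy (masking_game A A') Verifier,
     almost_sure_winning sigma (initial (masking_game A A'))
       (avoid [set verr A A'])).
Proof.
have masks_sure := masks_sure_winning (A := A) (A' := A').
(* Both equivalences follow from the cycle: masking, sure winning, almost-sure winning, masking. *)
split; split => [mAA'|[sigma win]].
- exact: masks_sure.
- exact: almost_sure_winning_masks (sure_almost_sure_avoid win).
- have [sigma win] := masks_sure mAA'.
  by exists sigma; exact: sure_almost_sure_avoid.
- exact: almost_sure_winning_masks win.
Qed.
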